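(* Let $r \ge 0$ be an integer and let $k = 2^r$. For every $k$-tuple $A_0 = (a_1, a_2, \dots, a_k)$ of nonnegative integers, with derived sets $A_0, A_1, A_2, \dots$ obtained by repeated cyclic absolute differencing, there exists an integer $n \ge 0$ such that every member of $A_n$ is zero.
   Context: A ''set'' of $k$ members here means an ordered $k$-tuple $(a_1,\dots,a_k)$ of nonnegative integers (repetitions allowed), with subscripts reduced modulo $k$, so that $a_{k+1} = a_1$. The differencing operator is $|\Delta| a_i = |a_{i+1} - a_i|$ for $i = 1, \dots, k$; in particular $|\Delta| a_k = |a_1 - a_k|$. Starting from the original set $A_0 = (a_1,\dots,a_k)$, the derived sets are $A_n = (|\Delta|^n a_1, \dots, |\Delta|^n a_k)$, where $|\Delta|^0 a_i = a_i$ and $|\Delta|^n a_i = \bigl|\, |\Delta|^{n-1} a_{i+1} - |\Delta|^{n-1} a_i \,\bigr|$ for $n \ge 1$ (subscripts modulo $k$). *)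

(* Defs.v *)
From mathcomp Require Import all_boot ssrint.

Set Implicit Arguments.
Unset Strict Implicit.
Unset Printing Implicit Defensive.

(* The subtraction inside [`|_ - _|%N] is that of [int], not the truncated one,
   and [ordS] wraps around: it sends the last index to the first. *)
Definition absdiff (k : nat) (a : k.-tuple nat) : k.-tuple nat :=
  [tuple `|tnth a (ordS i) - tnth a i|%N | i < k].

Definition derived_set (k : nat) (a : k.-tuple nat) (n : nat) : k.-tuple nat :=
  iter n (@absdiff k) a.

(* Main.v *)
Require Import Defs.
From mathcomp Require Import all_boot ssrint.
From mathcomp Require Import zify.

(* If d divides all entries, then |x - y| = x + y modulo 2d, so modulo 2d the
   operator acts as 1 + S, with S the cyclic shift, and its 2^s-th iterate acts
   as 1 + S^(2^s). For k = 2^r the shift S^k is the identity, hence k steps make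
   all entries divisible by 2d. The entries never exceed their initial maximum,
   so once they are divisible by a large power of 2 they vanish. *)

(** For [x <= y], the sum [x + y] exceeds [y - x] by [2x], a multiple of [2d]; the other order
    follows by symmetry. *)
Lemma modn_distn (d m n : nat) :
  d %| m -> d %| n -> `|m - n|%N = m + n %[mod d.*2].
Proof.
have main x y : d %| x -> d %| y -> x <= y -> `|x - y|%N = x + y %[mod d.*2].
  move=> /dvdnP[q ->] _ le_xy.
  have -> : q * d + y = q * d.*2 + `|(q * d)%N - y|%N by rewrite -muln2; lia.
  by rewrite modnMDl.
move=> dm dn; case/orP: (leq_total m n) => le_mn; first exact: main.
by rewrite distnC addnC; apply: main.
Qed.

Lemma dvdn_distn (d m n : nat) : d %| m -> d %| n -> d %| `|m - n|%N.
Proof.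
move=> dm dn; case/orP: (leq_total m n) => le_mn.
  by rewrite distnEr // dvdn_sub.
by rewrite distnEl // dvdn_sub.
Qed.

Lemma val_iter_ordS (k n : nat) (i : 'I_k) :
  iter n (@ordS k) i = (i + n) %% k :> nat.
Proof.
elim: n => [|n IHn]; first by rewrite addn0 modn_small.
by rewrite iterS /= IHn -addn1 modnDml addn1 addnS.
Qed.

Lemma iter_ordS_order (k : nat) (i : 'I_k) : iter k (@ordS k) i = i.
Proof. by apply: ord_inj; rewrite val_iter_ordS modnDr modn_small. Qed.

Lemma derived_setD (k m n : nat) (a : k.-tuple nat) :
  derived_set a (m + n) = derived_set (derived_set a n) m.
Proof. exact: iterD. Qed.

Lemma derived_set_dvdn (k d n : nat) (a : k.-tuple nat) :
  (forall i, d %| tnth a i) -> forall i, d %| tnth (derived_set a n) i.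
Proof.
by move=> da; elim: n => [|n IHn] i //=; rewrite tnth_mktuple dvdn_distn.
Qed.

Lemma derived_set_leq (k M n : nat) (a : k.-tuple nat) :
  (forall i, tnth a i <= M) -> forall i, tnth (derived_set a n) i <= M.
Proof.
move=> aM; elim: n => [|n IHn] i //=; rewrite tnth_mktuple.
by move: (IHn (ordS i)) (IHn i); rewrite /derived_set; lia.
Qed.

(** Induction on [s]: with T = S^(2^s), (1 + T)^2 = 1 + 2T + T^2, and the term 2T vanishes modulo
    [2d] on multiples of [d]. *)
Lemma derived_set_expn2_mod (k d s : nat) (a : k.-tuple nat) (i : 'I_k) :
  (forall i, d %| tnth a i) ->
  tnth (derived_set a (2 ^ s)) i
    = tnth a i + tnth a (iter (2 ^ s) (@ordS k) i) %[mod d.*2].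
Proof.
elim: s a i => [|s IHs] a i da.
  by rewrite /= tnth_mktuple addnC modn_distn.
rewrite expnS mul2n -addnn derived_setD IHs; last exact: derived_set_dvdn.
rewrite -modnDm !IHs // modnDm iterD.
set x := tnth a i; set y := tnth a _; set z := tnth a _.
(* The middle entry [y] is counted twice, once from each summand. *)
have /dvdnP[q ->] : d %| y by exact: da.
have -> : x + q * d + (q * d + z) = q * d.*2 + (x + z) by rewrite -muln2; lia.
by rewrite modnMDl.
Qed.

Lemma derived_set_dvdn_double (r d : nat) (a : (2 ^ r).-tuple nat) :
  (forall i, d %| tnth a i) ->
  forall i, d.*2 %| tnth (derived_set a (2 ^ r)) i.
Proof.
(* As S^(2^r) is the identity, the entry is congruent to twice [tnth a i]. *)
move=> da i; rewrite /dvdn derived_set_expn2_mod // iter_ordS_order addnn.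
by rewrite -/(dvdn _ _) -!muln2 dvdn_mul.
Qed.

Lemma derived_set_dvdn_expn2 (r m : nat) (a : (2 ^ r).-tuple nat) (i : 'I_(2 ^ r)) :
  2 ^ m %| tnth (derived_set a (m * 2 ^ r)) i.
Proof.
elim: m i => [|m IHm] i; first exact: dvd1n.
by rewrite expnS mul2n mulSn derived_setD derived_set_dvdn_double.
Qed.

Theorem theorem1 (r k : nat) (hk : k = 2 ^ r) (a : k.-tuple nat) :
  exists n : nat, forall i : 'I_k, tnth (derived_set a n) i = 0.
Proof.
subst k; pose M := \max_i tnth a i.
have aM i : tnth a i <= M by exact: leq_bigmax.
(* After [M] rounds of [2 ^ r] steps, [2 ^ M] divides every entry; a nonzero one would give
   [2 ^ M <= M], against [M < 2 ^ M]. *)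
exists (M * 2 ^ r) => i; apply/eqP; apply: contraTT (ltn_expl M (ltnSn 1)) => nz.
rewrite -leqNgt (leq_trans _ (derived_set_leq _ _ (M * 2 ^ r) a aM i)) //.
by rewrite dvdn_leq ?lt0n // derived_set_dvdn_expn2.
Qed.
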